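(* Let $n\ge 3$, let $K\subseteq\mathbb R^n$ be a proper cone, let $A\in\mathbb R^{n\times n}$ be a symmetric positive definite matrix, $b\in\mathbb R^n$, $c\in\mathbb R$, and let $f:\mathbb S^n\cap\operatorname{int}(K)\to\mathbb R$ be defined by $f(x)=\langle Ax,x\rangle+\langle b,x\rangle+c$. Then $f$ is spherically convex if and only if $$\frac12\langle b,x\rangle\le\lambda_{\min}(P_xAP_x+\lambda Q_x)-\langle Ax,x\rangle$$ for all $x\in\mathbb S^n\cap K$, where $P_x=I-xx^\top$, $Q_x=xx^\top$ and $\lambda=\langle Ar,r\rangle$ for some $r\in\mathbb S^n$ with $\langle r,x\rangle=0$.
   Context: $\langle x,y\rangle=x^\top y$ is the canonical inner product on $\mathbb R^n$, $\|\cdot\|$ the Euclidean norm, $\mathbb S^n=\{x\in\mathbb R^n:\|x\|=1\}$, $I$ is the identity matrix, and $\lambda_{\min}(M)$ is the smallest eigenvalue of a symmetric matrix $M$. A set $K\subseteq\mathbb R^n$ is a proper cone if $\lambda x\in K$ for all $x\in K,\lambda>0$; $x+y\in K$ for all $x,y\in K$; there is no $x\in K\setminus\{0\}$ with $-x\in K$; $K$ is closed; and $K$ has nonempty interior $\operatorname{int}(K)$. Geodesics of $\mathbb S^n$ are great circles (intersections of $\mathbb S^n$ with two-dimensional subspaces); a minimal geodesic segment is a shortest great-circle arc joining two points, parametrized proportionally to arc length. For a proper cone $K$, a function $f:\mathbb S^n\cap\operatorname{int}(K)\to\mathbb R$ is spherically convex if for every minimal geodesic segment $\gamma:J\to\mathbb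 S^n\cap\operatorname{int}(K)$ ($J$ an interval), the composition $f\circ\gamma$ is convex on $J$. *)

(* Defs.v *)
From HB Require Import structures.
From mathcomp Require Import all_boot all_order all_algebra.
From mathcomp Require Import all_classical all_reals all_analysis.

Set Implicit Arguments.
Unset Strict Implicit.
Unset Printing Implicit Defensive.

Import Order.TTheory GRing.Theory Num.Theory.
Import numFieldNormedType.Exports.

Local Open Scope classical_set_scope.
Local Open Scope ring_scope.

Section Euclidean.
Variables (R : realType) (n : nat).
Implicit Types (x y r : 'cV[R]_n) (M : 'M[R]_n).

Definition inner x y : R := (x^T *m y) 0 0.

Definition enorm x : R := Num.sqrt (inner x x).

Definition sphere : set 'cV[R]_n := [set x | enorm x = 1].

Definition posdef M : Prop := forall x, x != 0 -> 0 < inner (M *m x) x.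

Definition Qproj x : 'M[R]_n := x *m x^T.

Definition Pproj x : 'M[R]_n := 1%:M - Qproj x.

(* The default value 0 is only taken by matrices without a real eigenvalue;
   in particular never by a symmetric matrix of size n > 0. *)
Definition lambda_min M : R :=
  xget 0 [set a | eigenvalue M a /\ forall a', eigenvalue M a' -> a <= a'].

(* [closed] and the interior [K°] are taken in the library's (entrywise)
   topology of ['cV[R]_n], which is the Euclidean one. *)
Definition proper_cone (K : set 'cV[R]_n) : Prop :=
  [/\ forall x (l : R), K x -> 0 < l -> K (l *: x),
      forall x y, K x -> K y -> K (x + y),
      ~ (exists x, [/\ K x, x != 0 & K (- x)]),
      closed K
    & K° !=set0].

Definition great_circle (C : set 'cV[R]_n) : Prop :=
  exists V : {vspace 'cV[R]_n}, \dim V = 2 /\ C = sphere `&` [set` V].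

(* Arc length of a shortest great-circle arc from x to y, for x and y on the
   sphere. *)
Definition sphere_dist x y : R := acos (inner x y).

(* For orthogonal points u and v of a great circle, t |-> cos (k t) u + sin (k t) v
   runs through that circle with constant speed k, so that the arc from time s
   to time t has length k |t - s|; it is a shortest arc when this length is the
   distance of its end points. The initial phase is absorbed in the choice
   of u and v. The values of g outside of J are irrelevant. *)
Definition minimal_geodesic (J : interval R) (g : R -> 'cV[R]_n) : Prop :=
  exists (C : set 'cV[R]_n) (u v : 'cV[R]_n) (k : R),
    [/\ great_circle C,
        [/\ C u, C v & inner u v = 0],
        0 <= k,
        forall t, t \in J -> g t = cos (k * t) *: u + sin (k * t) *: v
      & forall s t, s \in J -> t \in J ->
          sphere_dist (g s) (g t) = k * `|t - s|].

(* Only the values of f on the intersection of the sphere with [K°] matter. *)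
Definition spherically_convex (K : set 'cV[R]_n) (f : 'cV[R]_n -> R) : Prop :=
  forall (J : interval R) (g : R -> 'cV[R]_n),
    minimal_geodesic J g ->
    (forall t, t \in J -> (sphere `&` K°) (g t)) ->
    @convex_function R R^o [set` J] (f \o g).

End Euclidean.

Arguments sphere {R n}.

(* Main.v *)
Require Import Defs.
From HB Require Import structures.
From mathcomp Require Import all_boot all_order all_algebra.
From mathcomp Require Import all_classical all_reals all_analysis.
From mathcomp Require Import ring lra.

Set Implicit Arguments.
Unset Strict Implicit.
Unset Printing Implicit Defensive.

Import Order.TTheory GRing.Theory Num.Theory.
Import numFieldNormedType.Exports.

Local Open Scope classical_set_scope.
Local Open Scope ring_scope.

(** A great circle through x with unit velocity v orthogonal to x is
    g t = cos t x + sin t v, and along it f is a trigonometric polynomial with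
    (f \o g)'' 0 = 2 <Av, v> - 2 <Ax, x> - <b, x>.  Hence f is spherically
    convex iff
      <b, x> / 2 + <Ax, x> <= <Av, v>                        (H)
    for all x on the sphere in the interior of K and all unit v orthogonal
    to x ([hessian_ge0]).  The proof of the theorem has three ingredients.

    - Reduction of convexity to (H).  From (H) to convexity
      ([hessian_spherically_convex]), the second derivative of f along any
      minimal geodesic is nonnegative.  From convexity to (H)
      ([spherically_convex_hessian]), no derivative is needed: midpoint
      convexity on a short arc centred at x gives
      <b, x> <= (1 + cos h) (<Av, v> - <Ax, x>), and h tends to 0.

    - Extension of (H) from the interior to all of K.  Condition (H) survives
      limits of x ([hessian_ge0_lim]), and every point of K on the sphere is a
      limit of interior points on the sphere ([cone_sphere_approx]).

    - Translation of (H) into the smallest eigenvalue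
      ([lambda_min_compression]).  P_x A P_x + l Q_x acts as the compression
      of A on the orthogonal complement of x and as l on the line of x.  For
      l = <Ar, r> with r a unit vector orthogonal to x, the value l is at least
      the minimum of <Av, v> over unit v orthogonal to x, so lambda_min is
      exactly that minimum, for every choice of r.  The variational formula for
      lambda_min of a symmetric matrix ([lambda_min_rayleigh]) comes from the
      compactness of the unit sphere. *)

(** * The Euclidean inner product *)

Section InnerProduct.
Variables (R : realType) (n : nat).
Implicit Types (x y z : 'cV[R]_n) (M : 'M[R]_n) (a : R).

Lemma innerE x y : inner x y = \sum_i x i 0 * y i 0.
Proof. by rewrite /inner mxE; apply: eq_bigr => i _; rewrite mxE. Qed.

Lemma innerC x y : inner x y = inner y x.
Proof. by rewrite !innerE; apply: eq_bigr => i _; rewrite mulrC. Qed.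

Lemma innerDl x y z : inner (x + y) z = inner x z + inner y z.
Proof. by rewrite /inner linearD mulmxDl mxE. Qed.

Lemma innerZl a x y : inner (a *: x) y = a * inner x y.
Proof. by rewrite /inner linearZ -scalemxAl mxE. Qed.

Lemma innerDr x y z : inner z (x + y) = inner z x + inner z y.
Proof. by rewrite !(innerC z) innerDl. Qed.

Lemma innerZr a x y : inner y (a *: x) = a * inner y x.
Proof. by rewrite !(innerC y) innerZl. Qed.

Lemma inner0l x : inner 0 x = 0.
Proof. by rewrite -[X in inner X _](scale0r 0) innerZl mul0r. Qed.

Lemma inner0r x : inner x 0 = 0.
Proof. by rewrite innerC inner0l. Qed.

Lemma innerNl x y : inner (- x) y = - inner x y.
Proof. by rewrite -scaleN1r innerZl mulN1r. Qed.

Lemma innerNr x y : inner y (- x) = - inner y x.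
Proof. by rewrite -scaleN1r innerZr mulN1r. Qed.

Lemma inner_adjoint M x y : inner (M *m x) y = inner x (M^T *m y).
Proof. by rewrite /inner trmx_mul mulmxA. Qed.

Lemma inner_ge0 x : 0 <= inner x x.
Proof. by rewrite innerE; apply: sumr_ge0 => i _; rewrite -expr2 sqr_ge0. Qed.

Lemma inner_eq0 x : (inner x x == 0) = (x == 0).
Proof.
apply/idP/eqP => [|->]; last by rewrite inner0l.
rewrite innerE psumr_eq0; last by move=> i _; rewrite -expr2 sqr_ge0.
move=> /allP h; apply/matrixP => i j; rewrite (ord1 j) mxE.
by have := h i (mem_index_enum i); rewrite /= mulf_eq0 orbb => /eqP.
Qed.

Lemma inner_gt0 x : x != 0 -> 0 < inner x x.
Proof. by move=> x0; rewrite lt_neqAle inner_ge0 eq_sym inner_eq0 x0. Qed.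

Lemma sphereE x : sphere x <-> inner x x = 1.
Proof.
rewrite /sphere /= /enorm; split => [h|->]; last by rewrite sqrtr1.
by rewrite -[LHS]sqr_sqrtr ?inner_ge0// h expr1n.
Qed.

Lemma enorm_gt0 x : x != 0 -> 0 < enorm x.
Proof. by move=> /inner_gt0; rewrite -sqrtr_gt0. Qed.

Lemma sqr_enorm x : enorm x ^+ 2 = inner x x.
Proof. by rewrite sqr_sqrtr ?inner_ge0. Qed.

Lemma sphere_normalize x : x != 0 -> sphere ((enorm x)^-1 *: x).
Proof.
move=> x0; apply/sphereE; rewrite innerZl innerZr -sqr_enorm.
by have := enorm_gt0 x0; move: (enorm x) => e e0; field; rewrite gt_eqF.
Qed.

Lemma sphere_neq0 x : sphere x -> x != 0.
Proof.
move=> /sphereE; apply: contra_eq_neq => ->.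
by rewrite inner0l eq_sym oner_eq0.
Qed.

Definition innerlin := (innerDl, innerDr, innerZl, innerZr, innerNl, innerNr).

(** Convergence is assumed entry by entry, so that the statement also covers
    transposes of converging row vectors. *)
Lemma cvg_inner_mulmx T (F : set_system T) (FF : Filter F) M
    (f g : T -> 'cV[R]_n) x y :
  (forall i, (fun t => f t i 0) @ F --> (x i 0 : R)) ->
  (forall i, (fun t => g t i 0) @ F --> (y i 0 : R)) ->
  (fun t => inner (M *m f t) (g t)) @ F --> inner (M *m x) y.
Proof.
move=> fx gy.
rewrite (_ : (fun t => _) =
   fun t => \sum_i (\sum_j M i j * f t j 0) * g t i 0); last first.
  by apply/funext => t; rewrite innerE; apply: eq_bigr => i _; rewrite mxE.
rewrite innerE; under eq_bigr do rewrite mxE.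
have addC : continuous (fun z : R * R => z.1 + z.2) by exact: add_continuous.
apply: cvg_big => // i _; apply: cvgM (gy i); apply: cvg_big => // j _.
by apply: cvgM (fx j); exact: cvg_cst.
Qed.

Lemma cvg_coord T (F : set_system T) (FF : Filter F) (f : T -> 'cV[R]_n) x i :
  f @ F --> x -> (fun t => f t i 0) @ F --> (x i 0 : R).
Proof.
move=> fx.
apply: (@cvg_comp _ _ _ f (fun y : 'cV[R]_n => y i 0) F (nbhs x)) => //.
exact: coord_continuous.
Qed.

Lemma cvg_inner T (F : set_system T) (FF : Filter F) (f g : T -> 'cV[R]_n) x y :
  f @ F --> x -> g @ F --> y ->
  (fun t => inner (f t) (g t)) @ F --> inner x y.
Proof.
move=> fx gy; rewrite -[x]mul1mx.
under eq_fun => t do rewrite -[f t]mul1mx.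
by apply: cvg_inner_mulmx => i; exact: cvg_coord.
Qed.

End InnerProduct.

(** * The smallest eigenvalue as a minimum of the Rayleigh quotient *)

Section Rayleigh.
Variables (R : realType) (n : nat).
Implicit Types (x y z w : 'cV[R]_n) (M : 'M[R]_n) (a : R).

(** The case [x = 0] bounds the quotient on the whole space. *)
Lemma rayleigh_ge_homog M x a :
  (forall v, sphere v -> inner v x = 0 -> a <= inner (M *m v) v) ->
  forall y, inner y x = 0 -> a * inner y y <= inner (M *m y) y.
Proof.
move=> ale y yx; have [->|y0] := eqVneq y 0; first by rewrite !inner0r mulr0.
have := ale _ (sphere_normalize y0).
rewrite -scalemxAr !innerlin yx mulr0 -sqr_enorm => /(_ erefl).
have := enorm_gt0 y0; move: (enorm y) => e e0.
by rewrite mulrA -invfM -expr2 mulrC ler_pdivlMr ?exprn_gt0.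
Qed.

(** The unit sphere is compact. Row vectors give access to
    [bounded_closed_compact]. *)
Lemma sphere_min_attained M : (0 < n)%N ->
  exists2 w, sphere w &
    forall z, inner (M *m w) w * inner z z <= inner (M *m z) z.
Proof.
move=> n0.
pose S : set 'rV[R]_n := [set u | inner u^T u^T = 1].
pose h (u : 'rV[R]_n) := inner (M *m u^T) u^T.
have trC (u : 'rV[R]_n) i : (fun v : 'rV[R]_n => v^T i 0) @ u --> u^T i 0.
  rewrite mxE; under eq_fun do rewrite mxE.
  exact: coord_continuous.
have hC : continuous h.
  by move=> u; apply: (cvg_inner_mulmx (nbhs_filter u)) => i; exact: trC.
have S0 : S !=set0.
  pose i0 := Ordinal n0.
  exists (\row_j (j == i0)%:R); rewrite /S /= innerE (bigD1 i0)//= !mxE eqxx.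
  rewrite mulr1 big1 ?addr0// => j /negPf ji.
  by rewrite !mxE ji mul0r.
have Sc : compact S.
  apply: bounded_closed_compact.
    exists 1; split => //= a a1 u /= Su.
    apply: le_trans (ltW a1); rewrite [leLHS]/Num.norm /= mx_normrE.
    apply/bigmax_leP; split => //= -[i j] _ /=.
    rewrite (ord1 i) -[leRHS]normr1 -ler_sqr ?nnegrE//.
    rewrite !real_normK ?num_real// expr1n -Su innerE (bigD1 j)//= !mxE.
    rewrite expr2 lerDl.
    by apply: sumr_ge0 => k _; rewrite -expr2 sqr_ge0.
  rewrite (_ : S = (fun u : 'rV[R]_n => inner (1%:M *m u^T) u^T) @^-1` [set 1]).
    apply: closed_comp; last exact: closed_eq.
    by move=> u _; apply: (cvg_inner_mulmx (nbhs_filter u)) => i; exact: trC.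
  by apply/seteqP; split => u /=; rewrite /S /= mul1mx.
have [|u] := EVT_min_rV S0 Sc (f := h).
  exact: continuous_subspaceT.
rewrite inE => Su umin; exists u^T; first exact/sphereE.
move=> z; apply: (@rayleigh_ge_homog _ 0); last exact: inner0r.
move=> v /sphereE v1 _; have := umin v^T.
by rewrite inE /S /h /= !trmxK; exact.
Qed.

(** The first variation at a minimizer of the Rayleigh quotient vanishes, which
    makes the minimizer an eigenvector. *)
Lemma rayleigh_min_eigenvector M w : M^T = M -> sphere w ->
  (forall z, inner (M *m w) w * inner z z <= inner (M *m z) z) ->
  M *m w = inner (M *m w) w *: w.
Proof.
move=> Ms /sphereE w1 hw; set m := inner (M *m w) w in hw *.
have [y yE] : exists y, y = M *m w - m *: w by eexists.
suff : inner y y == 0 by rewrite inner_eq0 yE subr_eq0 => /eqP.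
set p := inner y y.
have Mwy : inner (M *m w) y = p + m * inner w y.
  rewrite [LHS](_ : _ = inner (y + m *: w) y); last by rewrite yE subrK.
  by rewrite !innerlin.
pose q := inner (M *m y) y - m * inner y y.
have q0 : 0 <= q by rewrite subr_ge0.
have p0 : 0 <= p := inner_ge0 y.
rewrite eq_le p0 andbT.
(* y is the residual of the eigenvector equation; moving from w to w - e y
   changes the nonnegative form <Mz, z> - m <z, z> by -2 e p + e^2 q. *)
have key e : 0 <= e ^+ 2 * q - 2 * e * p.
  have := hw (w - e *: y).
  rewrite mulmxBr -scalemxAr !innerlin w1.
  have -> : inner (M *m y) w = inner (M *m w) y.
    by rewrite inner_adjoint Ms innerC.
  rewrite (innerC y w) Mwy -/m /q -/p; nra.
(* The best step would be p / q; q + 1 avoids a division by zero. *)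
have := key (p / (q + 1)).
have q1 : 0 < q + 1 by lra.
have -> : (p / (q + 1)) ^+ 2 * q - 2 * (p / (q + 1)) * p =
  - ((q + 2) * (p / (q + 1)) ^+ 2) by field; rewrite gt_eqF.
rewrite oppr_ge0 pmulr_rle0; last lra.
move=> h; have : p / (q + 1) == 0.
  by rewrite -sqrf_eq0 eq_le h sqr_ge0.
by rewrite mulf_eq0 invr_eq0 (gt_eqF q1) orbF => /eqP ->.
Qed.

Lemma eigenvalueP_col M a : M^T = M ->
  eigenvalue M a <-> exists2 w : 'cV[R]_n, w != 0 & M *m w = a *: w.
Proof.
move=> Ms; split => [/eigenvalueP[u uM u0]|[w w0 Mw]].
  exists u^T; first by rewrite trmx_eq0.
  by rewrite -{1}Ms -trmx_mul uM linearZ.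
apply/eigenvalueP; exists w^T; last by rewrite trmx_eq0.
by rewrite -{1}Ms -trmx_mul Mw linearZ.
Qed.

(** The minimum m of the Rayleigh quotient is an eigenvalue, and no eigenvalue
    is smaller since each one is a value of the quotient; this determines
    [lambda_min M] uniquely. *)
Lemma lambda_min_rayleigh M : (0 < n)%N -> M^T = M ->
  exists w, [/\ sphere w, inner (M *m w) w = lambda_min M &
    forall z, sphere z -> lambda_min M <= inner (M *m z) z].
Proof.
move=> n0 Ms; have [w Sw hw] := sphere_min_attained M n0.
have Mw := rayleigh_min_eigenvector Ms Sw hw.
suff E : lambda_min M = inner (M *m w) w.
  exists w; split => // z /sphereE z1.
  by have := hw z; rewrite z1 mulr1 E.
set m := inner (M *m w) w in hw Mw *.
have em : eigenvalue M m.
  by apply/eigenvalueP_col => //; exists w => //; exact: sphere_neq0.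
have mle a : eigenvalue M a -> m <= a.
  move=> /(eigenvalueP_col _ Ms)[z z0 Mz].
  by have := hw z; rewrite Mz innerZl ler_pM2r// inner_gt0.
apply: xget_unique => [//|a [ea ale]].
by apply/eqP; rewrite eq_le mle// ale.
Qed.

End Rayleigh.

(** * Compression to the orthogonal complement of a point *)

Section Compression.
Variables (R : realType) (n : nat).
Implicit Types (x y z v w r : 'cV[R]_n) (A : 'M[R]_n) (m : R).

Lemma exists_unit_orthogonal x : (1 < n)%N ->
  exists2 r, sphere r & inner r x = 0.
Proof.
move=> n1.
have : kermx x != 0.
  rewrite -mxrank_eq0 mxrank_ker subn_eq0 -ltnNge.
  exact: leq_ltn_trans (rank_leq_col x) n1.
move=> /rowV0Pn[u /sub_kermxP ux0 u0].
have ut0 : u^T != 0 by rewrite trmx_eq0.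
exists ((enorm u^T)^-1 *: u^T); first exact: sphere_normalize.
by rewrite innerZl /inner trmxK ux0 mxE mulr0.
Qed.

Lemma Qproj_mulmx x z : Qproj x *m z = inner x z *: x.
Proof. by rewrite /Qproj -mulmxA [x^T *m z]mx11_scalar mul_mx_scalar. Qed.

Lemma Qproj_sym x : (Qproj x)^T = Qproj x.
Proof. by rewrite /Qproj trmx_mul trmxK. Qed.

Lemma Pproj_sym x : (Pproj x)^T = Pproj x.
Proof. by rewrite /Pproj linearB /= trmx1 Qproj_sym. Qed.

Lemma Pproj_mulmx x z : Pproj x *m z = z - inner x z *: x.
Proof. by rewrite /Pproj mulmxBl mul1mx Qproj_mulmx. Qed.

Lemma compression_form A x l z :
  inner ((Pproj x *m A *m Pproj x + l *: Qproj x) *m z) z =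
  inner (A *m (z - inner x z *: x)) (z - inner x z *: x) + l * inner x z ^+ 2.
Proof.
rewrite mulmxDl innerDl -!mulmxA inner_adjoint Pproj_sym Pproj_mulmx.
by rewrite -scalemxAl Qproj_mulmx !innerZl expr2.
Qed.

(** The line spanned by x is an eigenspace for the value <A r, r>, which is
    itself a value of the Rayleigh quotient of A on the orthogonal complement
    of x; it therefore never lowers the minimum, whatever r is. *)
Lemma lambda_min_compression A x r m : A^T = A -> sphere x ->
  sphere r -> inner r x = 0 ->
  m <= lambda_min (Pproj x *m A *m Pproj x + inner (A *m r) r *: Qproj x) <->
  (forall v, sphere v -> inner v x = 0 -> m <= inner (A *m v) v).
Proof.
move=> As Sx Sr rx; set M := (_ + _ *: _).
have n0 : (0 < n)%N.
  case: n x Sx {r m As Sr rx M A} => // x.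
  by move=> /sphereE; rewrite innerE big_ord0 => /eqP; rewrite eq_sym oner_eq0.
have Ms : M^T = M.
  by rewrite /M linearD linearZ /= Qproj_sym 2!trmx_mul Pproj_sym As mulmxA.
have [w [Sw Mw Mmin]] := lambda_min_rayleigh n0 Ms.
split => [mM v Sv vx|mle].
  apply: le_trans mM (le_trans (Mmin v Sv) _).
  by rewrite compression_form (innerC x) vx scale0r subr0 expr0n mulr0 addr0.
rewrite -Mw compression_form; set y := w - _.
have /sphereE x1 := Sx; have /sphereE w1 := Sw.
have yx : inner y x = 0.
  by rewrite /y !innerlin x1 (innerC w) mulr1 subrr.
have yy : inner y y = 1 - inner x w ^+ 2.
  by rewrite /y !innerlin x1 w1 (innerC w); ring.
have := rayleigh_ge_homog mle yx; have := mle r Sr rx; rewrite yy.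
by have := sqr_ge0 (inner x w); nra.
Qed.

End Compression.

(** * Trigonometric polynomials of degree two *)

Section Trigonometry.
Variable R : realType.
Implicit Types (a b k p q r s m c t : R).
Local Open Scope convex_scope.

(** The restriction of a quadratic function to a parametrized great circle. *)
Definition trig_poly k p q r s m c t : R :=
  p * cos (k * t) ^+ 2 + q * (sin (k * t) * cos (k * t))
  + r * sin (k * t) ^+ 2 + s * cos (k * t) + m * sin (k * t) + c.

Lemma is_derive_cosM k t :
  is_derive t 1 (fun t => cos (k * t)) (- (k * sin (k * t))).
Proof.
have h : is_derive t 1 (fun t => k * t) k.
  by rewrite -[X in is_derive _ _ _ X]mulr1; exact: is_deriveZ.
by have := is_derive1_comp (is_derive_cos (k * t)) h; rewrite mulNr mulrC.
Qed.

Lemma is_derive_sinM k t :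
  is_derive t 1 (fun t => sin (k * t)) (k * cos (k * t)).
Proof.
have h : is_derive t 1 (fun t => k * t) k.
  by rewrite -[X in is_derive _ _ _ X]mulr1; exact: is_deriveZ.
by have := is_derive1_comp (is_derive_sin (k * t)) h; rewrite mulrC.
Qed.

(** The family [trig_poly] is closed under differentiation, so that the second
    derivative is obtained by applying this lemma twice. *)
Lemma is_derive_trig_poly k p q r s m c t :
  is_derive t 1 (trig_poly k p q r s m c)
    (trig_poly k (k * q) (2 * k * (r - p)) (- (k * q)) (k * m) (- (k * s)) 0 t).
Proof.
have hc := is_derive_cosM k t; have hs := is_derive_sinM k t.
by rewrite /trig_poly; apply: is_derive_eq; rewrite /GRing.scale /=; ring.
Qed.

Lemma derive_trig_poly k p q r s m c :
  'D_1 (trig_poly k p q r s m c) =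
  trig_poly k (k * q) (2 * k * (r - p)) (- (k * q)) (k * m) (- (k * s)) 0.
Proof.
apply/funext => t; have h := is_derive_trig_poly k p q r s m c t.
by rewrite derive_val.
Qed.

(** The hypothesis says that the second derivative, divided by k ^+ 2, is
    nonnegative; the form without k ^+ 2 also serves constant curves. *)
Lemma trig_poly_convex k p q r s m c a b (w : {i01 R}) :
  (forall t, a <= t <= b ->
    0 <= 2 * ((r - p) * (cos (k * t) ^+ 2 - sin (k * t) ^+ 2)
              - 2 * q * (sin (k * t) * cos (k * t)))
         - (s * cos (k * t) + m * sin (k * t))) ->
  a <= b ->
  trig_poly k p q r s m c ((a : R^o) <| w |> b) <=
  (trig_poly k p q r s m c a : R^o) <| w |> trig_poly k p q r s m c b.
Proof.
move=> h ab.
have D p' q' r' s' m' c' t : derivable (trig_poly k p' q' r' s' m' c') t 1.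
  by apply: ex_derive; exact: is_derive_trig_poly.
have C : continuous (trig_poly k p q r s m c).
  move=> t; apply: differentiable_continuous; exact/derivable1_diffP.
apply: second_derivative_convex => //.
- move=> t /andP[/ltW at_ /ltW tb]; rewrite derive_trig_poly.
  rewrite (@derive_val _ _ _ _ _ _ _ (is_derive_trig_poly _ _ _ _ _ _ _ _)).
  rewrite /trig_poly.
  have /h := introT andP (conj at_ tb).
  move: (cos _) (sin _) => C0 S0 h0.
  rewrite [leRHS](_ : _ = k ^+ 2 * (2 * ((r - p) * (C0 ^+ 2 - S0 ^+ 2)
    - 2 * q * (S0 * C0)) - (s * C0 + m * S0))); last ring.
  by rewrite mulr_ge0 ?sqr_ge0.
- exact/cvg_at_left_filter/C.
- exact/cvg_at_right_filter/C.
- by move=> t _; rewrite derive_trig_poly.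
Qed.

Lemma cos_lt1 t : 0 < t <= 1 -> cos t < 1.
Proof.
move=> /andP[t0 t1]; rewrite -cos0.
have p2 := pi_ge2 R.
by rewrite ltr_cos// in_itv/=; apply/andP; split; lra.
Qed.

End Trigonometry.

(** * Interior points of a cone *)

Section Cone.
Variables (R : realType) (n : nat).
Implicit Types (K : set 'cV[R]_n) (x y p u v : 'cV[R]_n) (a t : R).

Lemma interior_scale K p a : (forall x l, K x -> 0 < l -> K (l *: x)) ->
  K° p -> 0 < a -> K° (a *: p).
Proof.
move=> Kl Kp a0.
have a1 : a^-1 *: (a *: p) = p by rewrite scalerA mulVf ?scale1r// gt_eqF.
have nK : \forall y \near a *: p, K (a^-1 *: y).
  have : (fun y => a^-1 *: y) @ (a *: p) --> a^-1 *: (a *: p).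
    exact: scaler_continuous.
  by apply; rewrite a1.
apply: filterS nK => y /= Ky.
rewrite -[y]scale1r -(@mulfV _ a) ?gt_eqF// -scalerA.
exact: Kl.
Qed.

Lemma interior_add K x p : (forall x y, K x -> K y -> K (x + y)) ->
  K x -> K° p -> K° (x + p).
Proof.
move=> KD Kx Kp.
have Kp0 : \forall e \near (0 : 'cV[R]_n), K (p + e).
  exact: (proj1 (nbhs0P _ p)).
apply: (proj2 (nbhs0P _ (x + p))); apply: filterS Kp0 => e Kpe.
by rewrite -addrA; exact: KD.
Qed.

(** Adding a small multiple of an interior point moves a point of a cone into
    the interior; pointedness keeps the sum away from the origin. *)
Lemma cone_sphere_approx K x : proper_cone K -> sphere x -> K x ->
  exists2 u : R -> 'cV[R]_n, u @ 0^'+ --> x &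
    forall t, 0 < t -> sphere (u t) /\ K° (u t).
Proof.
move=> [Kl KD Kp _ [p pK]] Sx Kx.
exists (fun t => (enorm (x + t *: p))^-1 *: (x + t *: p)).
  have t0 : (fun t : R => t) @ 0^'+ --> (0 : R).
    exact: cvg_within.
  have c : (fun t : R => x + t *: p) @ 0^'+ --> x.
    rewrite -[X in _ --> X]addr0 -(scale0r p).
    by apply: cvgD; [exact: cvg_cst | exact: cvgZr_tmp].
  have e : (fun t : R => enorm (x + t *: p)) @ 0^'+ --> enorm x.
    apply: (@continuous_cvg _ _ _ _ _ (fun t => inner (x + t *: p) _)
      (@Num.sqrt R)).
      exact: sqrt_continuous.
    exact: cvg_inner.
  have e1 : enorm x = 1 := Sx.
  rewrite -[X in _ --> X]scale1r -invr1 -e1.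
  by apply: cvgZ => //; apply: cvgV => //; rewrite e1 oner_neq0.
move=> t t0.
have y0 : x + t *: p != 0.
  apply/eqP => /(canRL (addrK _)); rewrite add0r => xE.
  apply: Kp; exists x; split => //; first exact: sphere_neq0.
  by rewrite xE opprK; apply: Kl => //; exact: interior_subset.
split; first exact: sphere_normalize.
apply: interior_scale => //; last by rewrite invr_gt0 enorm_gt0.
by apply: interior_add => //; exact: interior_scale.
Qed.

End Cone.

(** * The second-order condition for spherical convexity *)

Section SecondOrder.
Variables (R : realType) (n : nat).
Implicit Types (K : set 'cV[R]_n) (x y p u v b : 'cV[R]_n) (A : 'M[R]_n).
Implicit Types (c t h e : R) (g : R -> 'cV[R]_n).
Local Open Scope convex_scope.

(** The Riemannian Hessian at x of <Ay, y> + <b, y> on the sphere is the form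
    v |-> 2 <Av, v> - 2 <Ax, x> - <b, x> on unit tangent vectors v; the
    condition is halved to match the lower bound on [lambda_min]. *)
Definition hessian_ge0 A b x := forall v, sphere v -> inner v x = 0 ->
  2^-1 * inner b x + inner (A *m x) x <= inner (A *m v) v.

Lemma cvg_ge0 T (F : set_system T) (FF : ProperFilter F) (f : T -> R) (l : R) :
  f @ F --> l -> (\forall t \near F, 0 <= f t) -> 0 <= l.
Proof.
move=> fl f0.
exact: (@closed_cvg T _ F FF f [set y | 0 <= y] (@closed_ge R 0) f0 l fl).
Qed.

(** A unit tangent vector v at the limit point x is the limit of its orthogonal
    projections w onto the tangent spaces at the points u t. These projections
    need not be unit vectors, hence the homogeneous form of the condition. *)
Lemma hessian_ge0_lim A b x T (F : set_system T) (FF : ProperFilter F)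
    (u : T -> 'cV[R]_n) :
  u @ F --> x -> (\forall t \near F, sphere (u t) /\ hessian_ge0 A b (u t)) ->
  hessian_ge0 A b x.
Proof.
move=> ux nu v /sphereE v1 vx; rewrite -subr_ge0.
pose w (t : T) := v - inner v (u t) *: u t.
pose m (t : T) := 2^-1 * inner b (u t) + inner (A *m u t) (u t).
have wv : w @ F --> v.
  rewrite -[X in _ --> X]subr0 -(scale0r x) -vx.
  apply: cvgB; first exact: cvg_cst.
  by apply: cvgZ => //; apply: cvg_inner => //; exact: cvg_cst.
have mx : m @ F --> 2^-1 * inner b x + inner (A *m x) x.
  apply: cvgD.
    by apply: cvgMl_tmp; apply: cvg_inner => //; exact: cvg_cst.
  by apply: cvg_inner_mulmx => i; apply: cvg_coord.
have ww : (fun t : T => inner (w t) (w t)) @ F --> (1 : R).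
  by rewrite -v1; exact: cvg_inner.
apply: (@cvg_ge0 _ F FF
  (fun t : T => inner (A *m w t) (w t) - m t * inner (w t) (w t))).
  apply: cvgB; first by apply: cvg_inner_mulmx => i; apply: cvg_coord.
  by rewrite -[X in _ --> X]mulr1; apply: cvgM.
apply: filterS nu => t [/sphereE ut1 ht]; rewrite subr_ge0.
apply: rayleigh_ge_homog ht _ _.
by rewrite /w !innerlin ut1 mulr1 subrr.
Qed.

Lemma quadratic_on_circle A b c x v t : A^T = A ->
  let g := cos t *: x + sin t *: v in
  inner (A *m g) g + inner b g + c =
  trig_poly 1 (inner (A *m x) x) (2 * inner (A *m x) v) (inner (A *m v) v)
    (inner b x) (inner b v) c t.
Proof.
move=> As g; rewrite /g /trig_poly mul1r mulmxDr -!scalemxAr !innerlin.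
have -> : inner (A *m v) x = inner (A *m x) v.
  by rewrite inner_adjoint As innerC.
ring.
Qed.

Lemma inner_circle x v s t : sphere x -> sphere v -> inner x v = 0 ->
  inner (cos s *: x + sin s *: v) (cos t *: x + sin t *: v) = cos (t - s).
Proof.
move=> /sphereE x1 /sphereE v1 xv.
by rewrite !innerlin x1 v1 (innerC v) xv cosB; ring.
Qed.

Lemma acos_cos_abs t : `|t| <= pi -> acos (cos t) = `|t|.
Proof.
have [t0|/ltW t0] := leP 0 t.
  by rewrite ger0_norm// => tpi; rewrite cosK// in_itv/= t0.
by rewrite ler0_norm// => tpi; rewrite cosKN// t0 andbT lerNl.
Qed.

Lemma great_circle_span x v : sphere x -> sphere v -> inner x v = 0 ->
  exists C, [/\ great_circle C, C x & C v].
Proof.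
move=> Sx Sv xv; exists (sphere `&` [set` <<[:: x; v]>>%VS]); split.
- exists <<[:: x; v]>>%VS; split => //; apply/eqP.
  rewrite -/(free [:: x; v]) free_cons seq1_free sphere_neq0// andbT.
  rewrite span_seq1; apply/vlineP => -[a xE].
  have : inner x v == 0 by rewrite xv.
  rewrite xE innerZl ((sphereE v).1 Sv) mulr1 => /eqP a0.
  by have /negP := sphere_neq0 Sx; apply; rewrite xE a0 scale0r.
- by split => //=; rewrite memv_span// inE eqxx.
- by split => //=; rewrite memv_span// !inE eqxx orbT.
Qed.

(** Two points of the arc are at most 2 <= pi apart in the parameter, so the
    arc between them is a shortest one. *)
Lemma minimal_geodesic_arc x v e : sphere x -> sphere v -> inner x v = 0 ->
  e <= 1 ->
  minimal_geodesic `]-e, e[ (fun t => cos t *: x + sin t *: v).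
Proof.
move=> Sx Sv xv e1; have [C [gC Cx Cv]] := great_circle_span Sx Sv xv.
exists C, x, v, 1; split => //; first by move=> t _; rewrite mul1r.
move=> s t; rewrite !in_itv/= => /andP[s1 s2] /andP[t1 t2].
rewrite /sphere_dist inner_circle// mul1r acos_cos_abs//.
by apply: le_trans (pi_ge2 R); rewrite ler_norml; apply/andP; split; lra.
Qed.

(** Convexity along a short arc, read at the midpoint of the arc from g (- h)
    to g h, is the inequality <b, x> <= (1 + cos h) (<Av, v> - <Ax, x>) once
    the positive factor 1 - cos h is removed; h then tends to 0. *)
Lemma spherically_convex_hessian K A b c (f : 'cV[R]_n -> R) x : A^T = A ->
  (forall x, (sphere `&` K°) x -> f x = inner (A *m x) x + inner b x + c) ->
  spherically_convex K f -> sphere x -> K° x -> hessian_ge0 A b x.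
Proof.
move=> As hf fc Sx Kx v Sv vx; have xv : inner x v = 0 by rewrite innerC.
pose g t := cos t *: x + sin t *: v.
have g0 : g 0 = x by rewrite /g cos0 sin0 scale1r scale0r addr0.
have gC : g @ (0 : R) --> g 0.
  apply: cvgD; apply: cvgZr_tmp.
  - exact: continuous_cos.
  - exact: continuous_sin.
have [e /= e0 eK] : \forall t \near (0 : R), K° (g t).
  by apply: gC; rewrite g0; exact: nbhs_interior.
pose d := Num.min e 1.
have d0 : 0 < d by rewrite lt_min e0 ltr01.
have d1 : d <= 1 by rewrite ge_min lexx orbT.
have SKg t : t \in `]-d, d[ -> (sphere `&` K°) (g t).
  move=> td; split.
    by apply/sphereE; rewrite inner_circle// subrr cos0.
  apply: eK => /=; rewrite sub0r normrN.
  move: td; rewrite in_itv/= -ltr_norml => /lt_le_trans; apply.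
  by rewrite ge_min lexx.
have fg t : t \in `]-d, d[ -> f (cos t *: x + sin t *: v) =
    trig_poly 1 (inner (A *m x) x) (2 * inner (A *m x) v) (inner (A *m v) v)
      (inner b x) (inner b v) c t.
  by move=> td; rewrite hf ?quadratic_on_circle//; exact: SKg.
have conv := fc _ _ (minimal_geodesic_arc Sx Sv xv d1) SKg.
have key h : 0 < h < d ->
    inner b x <= (1 + cos h) * (inner (A *m v) v - inner (A *m x) x).
  move=> /andP[h0 hd].
  have hJ : h \in `]-d, d[ by rewrite in_itv/=; apply/andP; split; lra.
  have hNJ : - h \in `]-d, d[ by rewrite in_itv/=; apply/andP; split; lra.
  have zJ : 0 \in `]-d, d[ by rewrite in_itv/=; apply/andP; split; lra.
  have p0 : 0 <= (2^-1 : R) by lra.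
  have p1 : (2^-1 : R) <= 1 by lra.
  have := conv (Itv01 p0 p1) h (- h) (mem_set hJ) (mem_set hNJ).
  have -> : (h : convex_lmodType R^o) <| Itv01 p0 p1 |> (- h) = 0.
    by transitivity (2^-1 * h + (1 - 2^-1) * - h) => //; lra.
  rewrite !convRE /= /unstable.onem !fg//.
  rewrite /trig_poly !mul1r cosN sinN cos0 sin0 sqrrN mulNr.
  have := cos2Dsin2 h; have : cos h < 1.
    by apply: cos_lt1; rewrite h0 (le_trans (ltW hd)).
  move: (cos h) (sin h) => C S C1 CS.
  have -> : S ^+ 2 = 1 - C ^+ 2 by lra.
  move=> mid; rewrite -subr_ge0 -(pmulr_rge0 _ (_ : 0 < 1 - C)); last by lra.
  by lra.
suff : 0 <= (1 + 1) * (inner (A *m v) v - inner (A *m x) x) - inner b x by lra.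
apply: (@cvg_ge0 _ (0 : R)^'+ _
  (fun h => (1 + cos h) * (inner (A *m v) v - inner (A *m x) x) - inner b x)).
  have cosC : cos @ (0 : R)^'+ --> (1 : R).
    rewrite -[X in _ --> X]cos0; apply: cvg_at_right_filter.
    exact: continuous_cos.
  apply: cvgB; last exact: cvg_cst.
  apply: cvgMr_tmp; apply: cvgD => //; exact: cvg_cst.
near=> h; rewrite subr_ge0; apply: key; apply/andP; split; near: h.
- exact: nbhs_right_gt.
- exact: nbhs_right_lt.
Unshelve. all: by end_near. Qed.

(** On a great circle the restriction is a trigonometric polynomial whose
    second derivative is the Hessian in the direction of the velocity. *)
Lemma hessian_spherically_convex K A b c (f : 'cV[R]_n -> R) : A^T = A ->
  (forall x, (sphere `&` K°) x -> f x = inner (A *m x) x + inner b x + c) ->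
  (forall x, sphere x -> K° x -> hessian_ge0 A b x) ->
  spherically_convex K f.
Proof.
move=> As hf H J g [C [u [v [k [[V [_ ->]] [[Su _] [Sv _] uv] k0 gE _]]]]] SKg.
pose F := trig_poly k (inner (A *m u) u) (2 * inner (A *m u) v)
  (inner (A *m v) v) (inner b u) (inner b v) c.
have fg t : t \in J -> f (g t) = F t.
  move=> tJ; rewrite hf; last exact: SKg.
  rewrite gE// quadratic_on_circle//.
  by rewrite /F /trig_poly mul1r.
have Fconv s t (w : {i01 R}) : s \in J -> t \in J -> s <= t ->
    F ((s : R^o) <| w |> t) <= ((F s : R^o) <| w |> F t).
  move=> sJ tJ st; apply: trig_poly_convex => // r rst.
  have rJ : r \in J := @interval_is_interval _ J s t sJ tJ r rst.
  have [Sg Kg] := SKg r rJ.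
  move: Sg Kg; rewrite gE// => Sg Kg.
  have /sphereE u1 := Su; have /sphereE v1 := Sv.
  have Sw : sphere (- sin (k * r) *: u + cos (k * r) *: v).
    apply/sphereE; rewrite !innerlin u1 v1 (innerC v) uv.
    by have := cos2Dsin2 (k * r); lra.
  have Avu : inner (A *m v) u = inner (A *m u) v.
    by rewrite inner_adjoint As innerC.
  (* The direction to test is the unit tangent of the great circle at the
     parameter r. *)
  have := H _ Sg Kg _ Sw; rewrite !mulmxDr -!scalemxAr !innerlin.
  rewrite u1 v1 (innerC v) uv Avu.
  by move: (cos _) (sin _) => C0 S0 /(_ ltac:(ring)) h; lra.
move=> w s t; rewrite !inE /= => sJ tJ.
have conv_J (a b' : R) (w' : {i01 R}) : a \in J -> b' \in J -> a <= b' ->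
    ((a : R^o) <| w' |> b') \in J.
  move=> aJ bJ ab; have := convR_itv w' ab; rewrite in_itv/=.
  exact: (@interval_is_interval _ J a b' aJ bJ).
have [st|/ltW ts] := leP s t.
  by rewrite /= !fg//; [exact: Fconv | exact: conv_J].
rewrite convC [leRHS]convC.
by rewrite !fg//; [exact: Fconv | exact: conv_J].
Qed.

End SecondOrder.

(** * The spectral characterization *)

Theorem theorem3 (R : realType) (n : nat) (hn : (3 <= n)%N)
    (K : set 'cV[R]_n) (hK : proper_cone K)
    (A : 'M[R]_n) (A_sym : A^T = A) (A_pos : posdef A)
    (b : 'cV[R]_n) (c : R) (f : 'cV[R]_n -> R)
    (hf : forall x, (sphere `&` K°) x ->
            f x = inner (A *m x) x + inner b x + c) :
  spherically_convex K f <->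
  (forall x, (sphere `&` K) x ->
     exists r : 'cV[R]_n, [/\ sphere r, inner r x = 0 &
       2^-1 * inner b x <=
         lambda_min (Pproj x *m A *m Pproj x + inner (A *m r) r *: Qproj x)
         - inner (A *m x) x]).
Proof.
have n1 : (1 < n)%N by exact: leq_trans hn.
split=> [fc x [Sx Kx]|H].
- have [r Sr rx] := exists_unit_orthogonal x n1.
  exists r; split => //; rewrite lerBrDr lambda_min_compression//.
  have [u ux uK] := cone_sphere_approx hK Sx Kx.
  apply: (@hessian_ge0_lim _ _ A b x _ (0 : R)^'+ _ u ux).
  near=> t; have [|Su Ku] := uK t.
    by near: t; exact: nbhs_right_gt.
  by split => //; exact: spherically_convex_hessian hf fc Su Ku.
- apply: (hessian_spherically_convex A_sym hf) => x Sx Kx.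
  have [r [Sr rx]] := H x (conj Sx (interior_subset Kx)).
  by rewrite lerBrDr lambda_min_compression.
Unshelve. all: by end_near. Qed.
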